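(* Let $n\geq 2$. Let $C\subset\mathbb{R}^n$ be a continuum. Assume that there exists an $(n-1)$-dimensional (affine) hyperplane $B\subset\mathbb{R}^n$ such that $B\cap C=\{p\}$ for a point $p$, and $C\setminus\{p\}$ is connected. Assume additionally that for every $x,y\in C\setminus\{p\}$ there exists a neighbourhood $U_{xy}$ of $p$ such that $\tilde{d}(x,y,C\setminus U_{xy})<+\infty$. Then there exists an embedding (homeomorphism onto its image) $h:C\to\mathbb{R}^n$ such that $h(C)$ is not an attractor of any iterated function system on $\mathbb{R}^n$.
   Context: A continuum is a nonempty compact connected metric space. $\mathbb{R}^n$ carries the Euclidean metric $d$. Definition of $\tilde d$: let $(X,d)$ be a metric space, $A\subset X$, $x,y\in A$, $\varepsilon>0$. Consider all finite sequences $x_1,\dots,x_k$ ($k\in\mathbb{N}$) with $x_1=x$, $x_k=y$, $x_i\in A$ for all $i$, and $d(x_i,x_{i+1})<\varepsilon$ for $1\le i\le k-1$. Let $\tilde d(x,y,A,\varepsilon)$ be the infimum of the sums $\sum_{i=1}^{k-1}d(x_i,x_{i+1})$ over all such sequences ($+\infty$ if there are none). Define $\tilde d(x,y,A)=\lim_{\varepsilon\searrow 0}\tilde d(x,y,A,\varepsilon)\in[0,+\infty]$. Since $\tilde d(x,y,A)$ is defined only for $x,y\in A$, writing $\tilde d(x,y,C\setminus U_{xy})$ entails $x,y\notin U_{xy}$. Let $(X,d)$ be a complete metric space. A map $f:X\to X$ is a contraction if there is $\lambda\in(0,1)$ with $d(f(x),f(y))\le\lambda d(x,y)$ for all $x,y\in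 X$. An iterated function system (IFS) on $X$ is a finite nonempty family $F=\{f_1,\dots,f_m\}$ of contractions $f_i:X\to X$. For compact $K\subset X$ put $F(K)=\bigcup_{i=1}^m f_i(K)$ (the Barnsley–Hutchinson operator). The attractor of $F$ is the unique nonempty compact set $A\subset X$ with $F(A)=A$.
   Formalization: The set C∖{p} is additionally assumed nonempty: if C={p} is a single point and the empty set counts as connected, the claim fails, since every one-point set is the attractor of a constant map. *)

(* Defs.v *)
From HB Require Import structures.
From mathcomp Require Import all_boot all_order all_algebra ring.
From mathcomp Require Import all_classical all_reals all_analysis.

Set Implicit Arguments.
Unset Strict Implicit.
Unset Printing Implicit Defensive.

Import Order.TTheory GRing.Theory Num.Theory.
Import numFieldTopology.Exports.

Local Open Scope classical_set_scope.
Local Open Scope ring_scope.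

(** The library metrizes ['rV[R]_n] by the sup norm. [euclid R n] is an alias
    that keeps the (product) topology and uniformity of ['rV[R]_n] but carries
    the Euclidean distance as its [metricType] structure; the two are proved
    compatible in [euclid_entourage]. *)
Definition euclid (R : realType) (n : nat) : Type := 'rV[R]_n.

Section euclid_metric.
Context {R : realType} {n : nat}.
Implicit Types x y z : 'rV[R]_n.

Definition edist x y : R := Num.sqrt (\sum_(i < n) (x 0 i - y 0 i) ^+ 2).

Let sqsum_ge0 (a : 'I_n -> R) : 0 <= \sum_(i < n) a i ^+ 2.
Proof. by apply: sumr_ge0 => i _; exact: sqr_ge0. Qed.

Lemma edist_ge0 x y : 0 <= edist x y.
Proof. exact: sqrtr_ge0. Qed.

Lemma edistxx x : edist x x = 0.
Proof.
by rewrite /edist big1 ?sqrtr0// => i _; rewrite subrr expr0n.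
Qed.

Lemma edistC x y : edist x y = edist y x.
Proof.
by rewrite /edist; congr Num.sqrt; apply: eq_bigr => i _; rewrite -sqrrN opprB.
Qed.

Lemma le_coord_edist x y i : `|x 0 i - y 0 i| <= edist x y.
Proof.
rewrite -sqrtr_sqr ler_wsqrtr// (bigD1 i)//= lerDl.
by apply: sumr_ge0 => j _; exact: sqr_ge0.
Qed.

Lemma edist_eq0 x y : edist x y = 0 -> x = y.
Proof.
move=> xy0; apply/rowP => i; apply/eqP; rewrite -subr_eq0 -normr_eq0.
by rewrite eq_le normr_ge0 andbT -xy0 le_coord_edist.
Qed.

Let cauchy_schwarz (a b : 'I_n -> R) :
  (\sum_(i < n) a i * b i) ^+ 2 <=
  (\sum_(i < n) a i ^+ 2) * (\sum_(i < n) b i ^+ 2).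
Proof.
set P := \sum_(i < n) _; set A := \sum_(i < n) _; set B := \sum_(i < n) _.
have B0 : 0 <= B by exact: sqsum_ge0.
have [Bz|Bnz] := eqVneq B 0.
  suff -> : P = 0 by rewrite expr0n/= Bz mulr0.
  rewrite /P big1// => i _.
  move/eqP: Bz; rewrite /B psumr_eq0; last by move=> j _; exact: sqr_ge0.
  move=> /allP/(_ i (mem_index_enum _))/=; rewrite sqrf_eq0 => /eqP ->.
  by rewrite mulr0.
have : 0 <= B * (A * B - P ^+ 2).
  suff <- : \sum_(i < n) (B * a i - P * b i) ^+ 2 = B * (A * B - P ^+ 2).
    exact: sqsum_ge0.
  transitivity (\sum_(i < n) (B ^+ 2 * a i ^+ 2 + (- (2 * B * P)) * (a i * b i)
                              + P ^+ 2 * b i ^+ 2)).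
    by apply: eq_bigr => i _; ring.
  by rewrite !big_split/= -!mulr_sumr -/P -/A -/B; ring.
by rewrite pmulr_rge0 ?subr_ge0// lt_neqAle eq_sym Bnz.
Qed.

Lemma edist_triangle x y z : edist x z <= edist x y + edist y z.
Proof.
rewrite /edist.
set a := fun i => x 0 i - y 0 i; set b := fun i => y 0 i - z 0 i.
rewrite -[leRHS]ger0_norm ?addr_ge0 ?sqrtr_ge0// -sqrtr_sqr ler_wsqrtr//.
rewrite sqrrD !sqr_sqrtr ?sqsum_ge0//.
have -> : \sum_(i < n) (x 0 i - z 0 i) ^+ 2 =
    \sum_(i < n) a i ^+ 2 + (\sum_(i < n) a i * b i) *+ 2 + \sum_(i < n) b i ^+ 2.
  rewrite -sumrMnl -!big_split/=; apply: eq_bigr => i _; rewrite /a /b; ring.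
rewrite lerD2r lerD2l lerMn2r/= -sqrtrM ?sqsum_ge0//.
by apply: (le_trans (ler_norm _)); rewrite -sqrtr_sqr ler_wsqrtr// cauchy_schwarz.
Qed.

Definition eball x (e : R) : set 'rV[R]_n := [set y | edist x y < e].

Lemma eball_center x e : 0 < e -> eball x e x.
Proof. by rewrite /eball/= edistxx. Qed.

Lemma eball_sym x y e : eball x e y -> eball y e x.
Proof. by rewrite /eball/= edistC. Qed.

Lemma eball_triangle x y z e1 e2 :
  eball x e1 y -> eball y e2 z -> eball x (e1 + e2) z.
Proof.
by move=> xy yz; exact: (le_lt_trans (edist_triangle x y z) (ltrD xy yz)).
Qed.

Lemma euclid_entourage :
  @entourage 'rV[R]_n = entourage_ (eball : 'rV[R]_n -> R -> set 'rV[R]_n).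
Proof.
rewrite -(@entourage_ballE R 'rV[R]_n); apply/seteqP; split=> E [e /= e0 eE].
  exists e => //= -[x y]/= xy; apply: eE => /=; split=> // i j.
  by rewrite (ord1 i); exact: le_lt_trans (le_coord_edist x y j) xy.
have d0 : 0 < e / n.+1%:R by rewrite divr_gt0.
exists (e / n.+1%:R) => //= -[x y]/= [_ xy]; apply: eE => /=.
rewrite /eball/= /edist -[ltRHS]ger0_norm ?ltW// -sqrtr_sqr ltr_sqrt ?exprn_gt0//.
apply: (@le_lt_trans _ _ (\sum_(i < n) (e / n.+1%:R) ^+ 2)).
  apply: ler_sum => i _; rewrite -[leLHS]real_normK ?num_real//.
  rewrite lerXn2r ?nnegrE ?(ltW d0)//.
  by have := xy 0 i; rewrite -ball_normE/= => /ltW.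
rewrite sumr_const card_ord -[ltLHS]mulr_natr expr_div_n mulrAC.
rewrite ltr_pdivrMr ?exprn_gt0// ltr_pM2l ?exprn_gt0//.
by rewrite expr2 -natrM ltr_nat mulSn ltnS leq_addr.
Qed.

End euclid_metric.

HB.instance Definition _ (R : realType) n := Uniform.copy (euclid R n) 'rV[R]_n.
HB.instance Definition _ (R : realType) n :=
  Uniform_isPseudoMetric.Build R (euclid R n)
    eball_center eball_sym eball_triangle euclid_entourage.
HB.instance Definition _ (R : realType) n :=
  PseudoMetric_isMetric.Build R (euclid R n)
    edist_ge0 edist_eq0 (fun _ _ => erefl).

Definition hyperplane (R : realType) n (B : set (euclid R n)) : Prop :=
  exists (a : 'rV[R]_n) (b : R),
    a != 0 /\ B = [set x : 'rV[R]_n | \sum_(i < n) a 0 i * x 0 i = b].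

Definition continuum (T : topologicalType) (C : set T) : Prop :=
  [/\ C !=set0, compact C & connected C].

(** [h] is only relevant on [C]; [g] is the inverse of [h : C -> h @` C]. *)
Definition embedding_on (T U : topologicalType) (C : set T) (h : T -> U) : Prop :=
  {within C, continuous h} /\
  exists g : U -> T,
    (forall x, C x -> g (h x) = x) /\ {within h @` C, continuous g}.

Section dtilde.
Context {R : realType} {X : metricType R}.
Implicit Types (x y : X) (A : set X).

(** The chain is [u 0, ..., u k]; the values of [u] beyond [k] are irrelevant. *)
Definition eps_chain x y A (eps : R) (k : nat) (u : nat -> X) : Prop :=
  [/\ u 0%N = x, u k = y, (forall i, (i <= k)%N -> A (u i)) &
      (forall i, (i < k)%N -> mdist (u i) (u i.+1) < eps)].

Definition chain_length (k : nat) (u : nat -> X) : R :=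
  \sum_(0 <= i < k) mdist (u i) (u i.+1).

(** [ereal_inf set0 = +oo]. *)
Definition dtilde_eps x y A (eps : R) : \bar R :=
  ereal_inf [set l | exists k u,
    eps_chain x y A eps k u /\ l = (chain_length k u)%:E].

(** [dtilde_eps] is nonincreasing in [eps], so this limit always exists. *)
Definition dtilde x y A : \bar R := lim (dtilde_eps x y A eps @[eps --> 0^'+]).

End dtilde.

Section ifs.
Context {R : realType} {X : metricType R}.

Definition contraction_map (f : X -> X) : Prop :=
  exists lambda : R, 0 < lambda < 1 /\
    forall x y, mdist (f x) (f y) <= lambda * mdist x y.

(** An IFS is indexed by ['I_m.+1], so that it is finite and nonempty. *)
Definition is_ifs (m : nat) (F : 'I_m.+1 -> X -> X) : Prop :=
  forall i, contraction_map (F i).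

Definition hutchinson (m : nat) (F : 'I_m.+1 -> X -> X) (K : set X) : set X :=
  \bigcup_(i in [set: 'I_m.+1]) (F i @` K).

(** In a complete space such an [A] is unique, by Hutchinson's theorem. *)
Definition attractor (m : nat) (F : 'I_m.+1 -> X -> X) (A : set X) : Prop :=
  [/\ A !=set0, compact A & hutchinson F A = A].

End ifs.

(* Main.v *)
Require Import Defs.
From mathcomp Require Import all_boot all_order all_algebra.
From mathcomp Require Import all_classical all_reals all_analysis.
From mathcomp Require Import ring lra.

Import Order.TTheory GRing.Theory Num.Theory.
Import numFieldTopology.Exports numFieldNormedType.Exports.
Local Open Scope classical_set_scope.
Local Open Scope ring_scope.

(** The set [C `\ p] lies strictly on one side of [B]. Squeeze [C] into a tube,
    of radius [O(t^2)] at height [t], around the curve [t sin (1/t)]: chains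
    from any point to the image [q] of [p] become arbitrarily long as their
    steps shrink, while away from [q] the map is Lipschitz, so [dtilde] stays
    finite between any two other points.

    Such a set [A] is not an attractor. If a contraction [f] of the system
    fixes [q], then [f] sends all of [A] to [q]: otherwise, for [x] with
    [f x <> q], chains from [x] to [f x], from [f x] to [f (f x)], ... have
    geometrically decreasing lengths and give a bounded chain from [x] to [q].
    If [f] moves [q], then [q] is not in [f @` A], because [f] preserves
    finiteness of [dtilde]. Hence [A `\ q] is a finite union of compact sets,
    and [q] would be isolated in the connected set [A]. *)

(** * Chains of bounded length with arbitrarily small steps *)

Section finite_chain_distance.
Set Implicit Arguments.
Unset Strict Implicit.
Context {R : realType}.

Definition has_chain {X : metricType R} (x y : X) (A : set X) (eps L : R) :=
  exists k u, eps_chain x y A eps k u /\ chain_length k u <= L.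

(** Since [dtilde_eps] grows as [eps] decreases, the limit defining [dtilde] is a supremum, and its
    finiteness amounts to one length bound serving every step size. *)
Definition dtilde_fin {X : metricType R} (x y : X) (A : set X) : Prop :=
  exists L : R, forall eps, 0 < eps -> has_chain x y A eps L.

Lemma dtilde_eps_nonincreasing {X : metricType R} (x y : X) (A : set X) eps eps' :
  eps <= eps' -> (dtilde_eps x y A eps' <= dtilde_eps x y A eps)%E.
Proof.
move=> ee'; apply: ereal_inf_le_tmp => _ [k [u [[u0 uk uA ue] ->]]].
exists k, u; split => //; split => // i /ue h; exact: lt_le_trans ee'.
Qed.

Lemma dtilde_lt_pinfty {X : metricType R} (x y : X) (A : set X) :
  (dtilde x y A < +oo)%E -> dtilde_fin x y A.
Proof.
have cvg_sup := @nonincreasing_at_right_cvge _ (dtilde_eps x y A) 0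
  (BInfty _ false) isT (fun e e' _ _ => @dtilde_eps_nonincreasing _ x y A e e').
rewrite /dtilde (cvg_lim _ cvg_sup)//; set S := ereal_sup _ => S_lt.
have [L SL] : exists L : R, (S < L%:E)%E.
  case: S S_lt => [r| |] //; last by exists 0; rewrite ltNyr.
  by move=> _; exists (r + 1); rewrite lte_fin ltrDl.
exists L => eps eps0.
have : (dtilde_eps x y A eps < L%:E)%E.
  apply: le_lt_trans SL; apply: ereal_sup_ubound; exists eps => //=.
  by rewrite in_itv/= eps0.
move=> /ereal_inf_lt[_ [k [u [cu ->]]]]; rewrite lte_fin => /ltW lL.
by exists k, u.
Qed.

Lemma has_chain_subset {X : metricType R} (x y : X) (A B : set X) eps L :
  A `<=` B -> has_chain x y A eps L -> has_chain x y B eps L.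
Proof.
move=> AB [k [u [[u0 uk uA ue] uL]]].
by exists k, u; split => //; split => // i /uA /AB.
Qed.

Lemma dtilde_fin_subset {X : metricType R} (x y : X) (A B : set X) :
  A `<=` B -> dtilde_fin x y A -> dtilde_fin x y B.
Proof.
by move=> AB [L hL]; exists L => eps /hL; exact: has_chain_subset.
Qed.

Lemma has_chain_cat {X : metricType R} (x y z : X) (A : set X) eps L L' :
  has_chain x y A eps L -> has_chain y z A eps L' -> has_chain x z A eps (L + L').
Proof.
move=> [k [u [[u0 uk uA ue] uL]]] [l [v [[v0 vl vA ve] vL]]].
exists (k + l)%N, (fun i => if (i < k)%N then u i else v (i - k)%N).
(* At [i = k] the glued chain already reads [v 0], which agrees with [u k]. *)
have wu i : (i <= k)%N ->
    (if (i < k)%N then u i else v (i - k)%N) = u i.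
  by rewrite leq_eqVlt => /predU1P[->|->//]; rewrite ltnn subnn v0.
have wv i : (if (i + k < k)%N then u (i + k)%N else v (i + k - k)%N) = v i.
  by rewrite addnK ltnNge leq_addl.
split; first split.
- by rewrite wu.
- by rewrite addnC wv.
- move=> i ikl; case: ifPn => [ik|]; first exact: uA (ltnW ik).
  by rewrite -leqNgt => ki; apply: vA; rewrite leq_subLR.
- move=> i ikl; have [ik|ki] := ltnP i k.
    by rewrite wu// ue.
  by rewrite -(subnK ki) -addSn wv addnK ve// ltn_subLR.
rewrite /chain_length (@big_cat_nat _ _ _ k)/= ?leq_addr//; apply: lerD.
  rewrite (le_trans _ uL)// /chain_length big_nat [leRHS]big_nat.
  apply: ler_sum => i /= ik.
  by rewrite ik wu.
rewrite (le_trans _ vL)// /chain_length -[X in \sum_(X <= _ < _) _]add0n big_addn addKn.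
by apply: ler_sum => i _; rewrite -addSn !wv.
Qed.

Lemma has_chain_image {X Y : metricType R} (f : X -> Y) (D : set X) (E : set Y)
    (x y : X) (c eps L : R) :
  0 < c -> (forall x y, D x -> D y -> mdist (f x) (f y) <= c * mdist x y) ->
  f @` D `<=` E -> has_chain x y D eps L ->
  has_chain (f x) (f y) E (c * eps) (c * L).
Proof.
move=> c0 fc fDE [k [u [[u0 uk uA ue] uL]]].
exists k, (f \o u); split; first split => /=.
- by rewrite u0.
- by rewrite uk.
- by move=> i /uA ?; apply: fDE; exists (u i).
- move=> i ik; apply: le_lt_trans (fc _ _ (uA _ (ltnW ik)) (uA _ ik)) _.
  by rewrite ltr_pM2l// ue.
apply: (@le_trans _ _ (c * chain_length k u)); last by rewrite ler_pM2l.
rewrite /chain_length mulr_sumr big_nat [leRHS]big_nat; apply: ler_sum => i /= ik.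
by apply: fc; apply: uA => //; exact: ltnW.
Qed.

Lemma dtilde_fin_image {X Y : metricType R} (f : X -> Y) (D : set X) (E : set Y)
    (x y : X) (c : R) :
  0 < c -> (forall x y, D x -> D y -> mdist (f x) (f y) <= c * mdist x y) ->
  f @` D `<=` E -> dtilde_fin x y D -> dtilde_fin (f x) (f y) E.
Proof.
move=> c0 fc fDE [L hL]; exists (c * L) => eps eps0.
have := hL (c^-1 * eps) (mulr_gt0 _ eps0); rewrite invr_gt0 => /(_ c0).
by move=> /(has_chain_image c0 fc fDE); rewrite mulrA divff ?gt_eqF// mul1r.
Qed.

End finite_chain_distance.

(** * Contractions on a set with one infinitely distant point *)

Section attractor_obstruction.
Set Implicit Arguments.
Unset Strict Implicit.
Context {R : realType} {X : metricType R}.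
Implicit Types (A : set X) (q : X).

(** Prefixing a chain from [x] to [f x] to the [f]-image of a chain from [x] to the [N]-th iterate
    reaches the next iterate; the bound [S = L / (1 - l)] survives because [S = L + l * S]. Once an
    iterate is within [eps] of [q], a single further step closes the chain, at a cost of at most
    [mdist x q]. *)
Lemma dtilde_fin_fixpoint (f : X -> X) A q x :
  contraction_map f -> f @` A `<=` A -> A q -> A x -> f q = q ->
  dtilde_fin x (f x) A -> dtilde_fin x q A.
Proof.
move=> [l [/andP[l0 l1] fl]] fA Aq Ax fq [L hL].
have L0 : 0 <= L.
  have [k [u [_ +]]] := hL 1 ltr01; apply: le_trans.
  by apply: sumr_ge0 => i _; exact: mdist_ge0.
have l1' : 0 < 1 - l by rewrite subr_gt0.
pose S := L / (1 - l); exists (S + mdist x q) => eps eps0.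
have chainN N : has_chain x (iter N f x) A eps S.
  elim: N => [|N IH].
    exists 0%N, (fun=> x); split; first by split.
    by rewrite /chain_length big_geq// divr_ge0// ltW.
  have -> : S = L + l * S by rewrite /S; field; rewrite gt_eqF.
  apply: has_chain_cat (hL _ eps0) _.
  have [k [u [[u0 uk uA ue] uL]]] :=
    has_chain_image l0 (fun x y _ _ => fl x y) fA IH.
  exists k, u; split => //; split => //.
  (* Image steps are below [l * eps], hence still below [eps]. *)
  move=> i /ue/lt_le_trans; apply.
  by rewrite ger_pMl// ltW.
have AN N : A (iter N f x) by elim: N => //= N IH; apply: fA; exists (iter N f x).
have distN N : mdist (iter N f x) q <= l ^+ N * mdist x q.
  elim: N => [|N IH]; first by rewrite expr0 mul1r.
  rewrite iterS -{1}fq exprS -mulrA; apply: le_trans (fl _ _) _.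
  by rewrite ler_pM2l.
have : (fun N => l ^+ N * mdist x q) @ \oo --> (0 : R).
  rewrite -(mul0r (mdist x q)); apply: cvgMl.
  by apply: cvg_expr; rewrite ger0_norm// ltW.
move=> /cvgrPdist_lt/(_ _ eps0)[N _ /(_ N (leqnn _))]/=.
rewrite sub0r normrN ger0_norm ?mulr_ge0 ?exprn_ge0 ?mdist_ge0 1?ltW// => lN.
apply: has_chain_cat (chainN N) _.
exists 1%N, (fun i => if i is 0%N then iter N f x else q); split; first split => //.
- by case.
- by case=> // _; exact: le_lt_trans lN.
rewrite /chain_length big_nat1; apply: le_trans (distN N) _.
by rewrite ler_piMl ?mdist_ge0// exprn_ile1 ?ltW.
Qed.

Lemma closed_singleton q : closed [set q].
Proof.
exact: accessible_closed_set1 (hausdorff_accessible (@metric_hausdorff _ X)) _.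
Qed.

(** The complement of [K] meets [A] in [q] alone, so the singleton is both relatively open and
    relatively closed in [A]. *)
Lemma connected_isolated A q K : connected A -> A q -> closed K ->
  A `&` K = A `\ q -> A = [set q].
Proof.
move=> cA Aq cK AK; apply/esym; apply: cA; first by exists q.
- exists (~` K); first by rewrite openC.
  apply/seteqP; split => x /=.
    move=> ->; split => // Kq.
    by have : (A `&` K) q by []; rewrite AK => -[_]; apply.
  move=> [Ax nKx]; apply: contrapT => xq; apply: nKx.
  by have : (A `\ q) x by []; rewrite -AK => -[].
- exists [set q]; first exact: closed_singleton.
  by apply/seteqP; split => x /=; [move=> ->|case].
Qed.

Lemma contraction_continuous (f : X -> X) : contraction_map f -> continuous f.
Proof.
move=> [l [/andP[l0 l1] fl]] x; apply/metricType_numDomainType.cvgrPdist_lt => eps eps0.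
near=> y; apply: le_lt_trans (fl x y) _.
rewrite -ltr_pdivlMl//; near: y.
by apply: (metricType_numDomainType.cvgr_dist_lt cvg_id); rewrite mulr_gt0// invr_gt0.
Unshelve. all: by end_near. Qed.

Lemma not_attractor A q : connected A -> A q -> (A `\ q) !=set0 ->
  (forall x y, (A `\ q) x -> (A `\ q) y -> dtilde_fin x y A) ->
  (forall x, (A `\ q) x -> ~ dtilde_fin x q A) ->
  forall m (F : 'I_m.+1 -> X -> X), is_ifs F -> ~ attractor F A.
Proof.
move=> cA Aq [x0 [Ax0 /= x0q]] finA infq m F ifsF [_ compA FA].
have Anq : A <> [set q] by move=> Aq1; apply: x0q; rewrite Aq1 in Ax0.
have FAA i : F i @` A `<=` A by rewrite -[X in _ `<=` X]FA => x Fx; exists i.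
have Fc i : continuous (F i) by exact: contraction_continuous.
have fixq i : F i q = q -> F i @` A `<=` [set q].
  move=> Fq _ [x Ax <-] /=; apply: contrapT => Fxq.
  have xq : x <> q by move=> xq; apply: Fxq; rewrite xq.
  apply: (infq x) => //.
  apply: (dtilde_fin_fixpoint (ifsF i)) => //.
  by apply: finA => //; split => //; apply: FAA; exists x.
have movq i : F i q <> q -> ~ (F i @` A) q.
  move=> Fqq [x Ax Fx].
  have xq : x <> q by move=> xq; apply: Fqq; rewrite -{1}xq.
  (* The fibre of [F i] over [q] misses [q]. It contains every other [y] of [A]: were [F i y <> q],
     the Lipschitz map would carry the finite chain distance between [y] and [x] to one between
     [F i y] and [F i x = q]. So [q] would be isolated. *)
  apply: Anq; apply: (@connected_isolated _ _ (F i @^-1` [set q])) => //.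
    by apply: closed_comp => //; exact: closed_singleton.
  apply/seteqP; split => y /=.
    by move=> [Ay Fy]; split => // yq; apply: Fqq; rewrite -{1}yq.
  move=> [Ay yq]; split => //; apply: contrapT => Fyq.
  apply: (infq (F i y)); first by split => //; apply: FAA; exists y.
  have [l [/andP[l0 _] fl]] := ifsF i.
  rewrite -Fx; apply: (dtilde_fin_image l0 _ (FAA i)) => //.
  by apply: finA; split.
apply: Anq.
apply: (@connected_isolated _ _ (\bigcup_(i in [set i | F i q <> q]) F i @` A)) => //.
  apply: closed_bigcup => [|i _]; first exact: finite_finset.
  apply: compact_closed; first exact: metric_hausdorff.
  by apply: continuous_compact => //; exact: continuous_subspaceT.
apply/seteqP; split => y /=.
  by move=> [Ay [i /= Fq FAy]]; split => // yq; apply: (movq i) => //; rewrite -yq.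
move=> [Ay yq]; split => //; move: Ay; rewrite -{1}FA => -[i _ Fy].
exists i => //= Fq; apply: yq; exact: fixq Fq _ Fy.
Qed.

End attractor_obstruction.

(** * Length of chains passing through alternating levels *)

Section oscillation.
Context {R : realType} {X : metricType R}.
Set Implicit Arguments.
Unset Strict Implicit.

Lemma mdist_le_chain (u : nat -> X) i j : (i <= j)%N ->
  mdist (u i) (u j) <= \sum_(i <= l < j) mdist (u l) (u l.+1).
Proof.
move=> /subnK <-; elim: (j - i)%N => [|d IH].
  by rewrite add0n big_geq// mdistxx.
rewrite addSn big_nat_recr/= ?leq_addl//.
by apply: le_trans (metric_triangle _ (u (d + i)%N) _) _; rewrite lerD2r.
Qed.

(** A discrete intermediate value argument: peeling indices off the end finds the last one before
    [k] at which [f] exceeds [T]. *)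
Lemma downcrossing (f : nat -> R) (T : R) i k : (i <= k)%N ->
  T < f i -> f k <= T -> exists j, [/\ (i <= j < k)%N, T < f j & f j.+1 <= T].
Proof.
move=> /subnK <-; elim: (k - i)%N => [|d IH] Ti.
  by rewrite add0n leNgt Ti.
rewrite addSn => dT; have [Td|dT'] := ltP T (f (d + i)%N).
  by exists (d + i)%N; split => //; rewrite leq_addl leqnn.
have [j [/andP[ij jd] Tj jT]] := IH Ti dT'.
by exists j; split => //; rewrite ij ltnW.
Qed.

(* A chain from above level [t 0] to [q] with small steps must land just below
   each of the levels [t 0], ..., [t K] in turn, where the sign of [s]
   alternates. *)
Lemma oscillation_dtilde_infinite (A : set X) (tau s : X -> R) (c : R)
    (t w : nat -> R) (x q : X) :
  0 < c ->
  (forall y z, `|tau y - tau z| <= c * mdist y z) ->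
  (forall y z, `|s y - s z| <= c * mdist y z) ->
  (forall k, t k.+1 < t k) -> (forall k, 0 <= w k) ->
  (forall k, exists2 eta, 0 < eta & forall z, A z ->
     t k - eta < tau z <= t k -> w k <= (-1) ^+ k * s z) ->
  (forall L, exists K, L < \sum_(0 <= k < K) w k) ->
  t 0%N < tau x -> (forall k, tau q < t k) -> ~ dtilde_fin x q A.
Proof.
move=> c0 tauc sc tdec w0 win wdiv tx tq [L hL].
(* Each [eta] is capped by the gap to the next level, so a point in the window below [t k] still
   lies above [t k.+1], which the chain has yet to cross. *)
have {}win k : exists eta, [/\ 0 < eta, eta <= t k - t k.+1 & forall z, A z ->
     t k - eta < tau z <= t k -> w k <= (-1) ^+ k * s z].
  have [e e0 he] := win k; exists (Num.min e (t k - t k.+1)); split.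
  - by rewrite lt_min e0 subr_gt0 tdec.
  - by rewrite ge_min lexx orbT.
  - move=> z Az /andP[ez zt]; apply: he => //; rewrite zt andbT.
    by apply: le_lt_trans ez; rewrite lerD2l lerN2 ge_min lexx.
have {win}[eta eta_win] := choice win.
have eta0 k : 0 < eta k by case: (eta_win k).
have eta_gap k : eta k <= t k - t k.+1 by case: (eta_win k).
have {eta_win}win k z : A z -> t k - eta k < tau z <= t k ->
    w k <= (-1) ^+ k * s z by case: (eta_win k) => _ _; exact.
(* By induction on [K], the chain up to its visit [u i] to window [K] has paid for the weights of
   index below [K]; [w K] is paid only on the way to the next window. *)
suff visit : forall K, exists2 eps, 0 < eps & forall k u, eps_chain x q A eps k u ->
    exists i, [/\ (i <= k)%N, t K - eta K < tau (u i) <= t K &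
      \sum_(0 <= j < K) w j <= c * chain_length i u].
  have [K LK] := wdiv (c * L).
  have [eps eps0 heps] := visit K.
  have [k [u [cu uL]]] := hL _ eps0.
  have [i [ik _ wi]] := heps _ _ cu.
  have : chain_length i u <= chain_length k u.
    rewrite /chain_length (@big_cat_nat _ _ _ i 0 k)//= lerDl.
    by apply: sumr_ge0 => j _; exact: mdist_ge0.
  move=> /le_trans/(_ uL); rewrite -(ler_pM2l c0).
  by move=> /(le_trans wi); rewrite leNgt LK.
(* One step lowers [tau] by at most [c * eps], so the step crossing level [t K] lands within [eta K]
   of it. *)
have land eps K k u i : c * eps <= eta K -> eps_chain x q A eps k u ->
    (i <= k)%N -> t K < tau (u i) ->
    exists j, [/\ (i <= j <= k)%N, A (u j) & t K - eta K < tau (u j) <= t K].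
  move=> ceps [u0 uk uA ue] ik ti.
  have [|j [/andP[ij jk] tj jt]] := @downcrossing (tau \o u) (t K) i k ik ti.
    by rewrite /= uk ltW.
  exists j.+1; split; [by rewrite (leqW ij) jk|exact: uA|].
  rewrite jt andbT ltrBlDr.
  apply: lt_le_trans tj _; rewrite -lerBlDl.
  apply: le_trans (ler_norm _) _; apply: le_trans (tauc _ _) _.
  by apply: le_trans ceps; rewrite ler_pM2l// ltW// ue.
elim=> [|K [eps eps0 IH]].
  exists (eta 0%N / c); first by rewrite divr_gt0.
  move=> k u cu; have [|||j [/andP[_ jk] _ jt]] := land _ 0%N _ _ 0%N _ cu.
  - by rewrite mulrC divfK ?gt_eqF.
  - by [].
  - by case: cu => ->.
  exists j; split => //; rewrite big_geq// mulr_ge0 ?(ltW c0)//.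
  by apply: sumr_ge0 => l _; exact: mdist_ge0.
exists (Num.min eps (eta K.+1 / c)).
  by rewrite lt_min eps0 divr_gt0.
move=> k u cu; have [u0 uk uA ue] := cu.
have [|i [ik /[dup] iwin /andP[ti it] wi]] := IH k u.
  by split => // j /ue; rewrite lt_min => /andP[].
have [|||j [/andP[ij jk] Aj jt]] := land _ K.+1 _ _ i _ cu.
- by rewrite -ler_pdivlMl// mulrC ge_min lexx orbT.
- by [].
- by apply: le_lt_trans ti; rewrite lerBrDr -lerBrDl.
exists j; split => //.
rewrite big_nat_recr//= /chain_length (@big_cat_nat _ _ _ i 0 j)//= mulrDr.
apply: lerD => //; apply: (@le_trans _ _ (c * mdist (u i) (u j))); last first.
  by rewrite ler_pM2l// mdist_le_chain.
apply: le_trans (sc _ _).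
(* The value of [s] in window [K] contributes [w K]; from window [K.+1] only the opposite sign is
   used. *)
have wK := win K _ (uA _ ik) iwin.
have := win K.+1 _ Aj jt; rewrite exprS mulN1r mulNr => /(le_trans (w0 _)).
rewrite oppr_ge0 => sj.
apply: (@le_trans _ _ ((-1) ^+ K * (s (u i) - s (u j)))).
  by rewrite mulrBr; lra.
by apply: le_trans (ler_norm _) _; rewrite normrM normrX normrN1 expr1n mul1r.
Qed.

End oscillation.

(** * Calculus of Lipschitz maps on a set *)

Section lipschitz_on_sets.
Context {R : realType}.
Set Implicit Arguments.
Unset Strict Implicit.

Definition lip {V W : normedModType R} (D : set V) (f : V -> W) : Prop :=
  exists k, forall x y, D x -> D y -> `|f x - f y| <= k * `|x - y|.

Lemma lip_ge0 {V W : normedModType R} (D : set V) (f : V -> W) : lip D f ->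
  exists2 k, 0 <= k & forall x y, D x -> D y -> `|f x - f y| <= k * `|x - y|.
Proof.
move=> [k fk]; exists `|k| => // x y Dx Dy; apply: le_trans (fk _ _ Dx Dy) _.
by rewrite ler_wpM2r// ler_norm.
Qed.

Lemma lip_bounded {V W : normedModType R} (D : set V) (f : V -> W) (M : R) :
  (forall x, D x -> `|x| <= M) -> lip D f ->
  exists2 N, 0 <= N & forall x, D x -> `|f x| <= N.
Proof.
move=> DM /lip_ge0[k k0 fk].
have [[z Dz]|D0] := pselect (D !=set0); last first.
  by exists 0 => // x Dx; exfalso; apply: D0; exists x.
exists (k * (M + M) + `|f z|) => [|x Dx].
  by rewrite addr_ge0// mulr_ge0// addr_ge0// (le_trans _ (DM _ Dz)).
rewrite -[f x](subrK (f z)); apply: le_trans (ler_normD _ _) _.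
rewrite lerD2r; apply: le_trans (fk _ _ Dx Dz) _; rewrite ler_wpM2l//.
by apply: le_trans (ler_normB _ _) _; rewrite lerD// DM.
Qed.

Lemma lip_cst {V W : normedModType R} (D : set V) (w : W) : lip D (fun=> w).
Proof. by exists 0 => x y _ _; rewrite subrr normr0 mul0r. Qed.

Lemma lip_subr {V : normedModType R} (D : set V) p : lip D (fun x => x - p).
Proof.
by exists 1 => x y _ _; rewrite mul1r opprB addrA subrK.
Qed.

Lemma lip_add {V W : normedModType R} (D : set V) (f g : V -> W) :
  lip D f -> lip D g -> lip D (fun x => f x + g x).
Proof.
move=> [k fk] [l gl]; exists (k + l) => x y Dx Dy.
by rewrite opprD addrACA mulrDl (le_trans (ler_normD _ _))// lerD ?fk ?gl.
Qed.

(** The product rule needs both factors bounded; Lipschitz maps on a bounded set are, hence the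
    bound [M] on the domain. *)
Lemma lip_scale {V W : normedModType R} (D : set V) (f : V -> R) (g : V -> W) (M : R) :
  (forall x, D x -> `|x| <= M) ->
  lip D f -> lip D g -> lip D (fun x => f x *: g x).
Proof.
move=> DM Lf Lg.
have [N N0 gN] := lip_bounded DM Lg.
have [k k0 fk] := lip_ge0 Lf; have [l l0 gl] := lip_ge0 Lg.
have [Q Q0 fQ] := lip_bounded DM Lf.
exists (k * N + Q * l) => x y Dx Dy.
have -> : f x *: g x - f y *: g y = (f x - f y) *: g x + f y *: (g x - g y).
  by rewrite scalerBl scalerBr addrA subrK.
rewrite mulrDl (le_trans (ler_normD _ _))// !normrZ lerD//.
  by rewrite mulrAC ler_pM// ?fk ?gN.
by rewrite -mulrA ler_pM ?fQ ?gl.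
Qed.

Lemma lip_comp {V W Z : normedModType R} (D : set V) (E : set W)
    (f : V -> W) (g : W -> Z) :
  lip D f -> f @` D `<=` E -> lip E g -> lip D (g \o f).
Proof.
move=> [k fk] fDE /lip_ge0[l l0 gl]; exists (l * k) => x y Dx Dy /=.
apply: le_trans (gl _ _ _ _) _; [by apply: fDE; exists x|by apply: fDE; exists y|].
by rewrite -mulrA ler_wpM2l// fk.
Qed.

Lemma lip_inv (delta : R) : 0 < delta -> lip [set x : R | delta <= x] (fun x => x^-1).
Proof.
(* The difference of reciprocals is [(y - x) / (x * y)], with denominator at least [delta ^+ 2]. *)
move=> d0; exists (delta ^- 2) => x y /= dx dy.
have x0 : 0 < x by exact: lt_le_trans dx.
have y0 : 0 < y by exact: lt_le_trans dy.
have -> : x^-1 - y^-1 = (x * y)^-1 * (y - x) by field; rewrite !gt_eqF.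
rewrite normrM [`|y - x|]distrC ler_wpM2r// gtr0_norm ?invr_gt0 ?mulr_gt0//.
by rewrite lef_pV2 ?posrE ?exprn_gt0 ?mulr_gt0// expr2 ler_pM ?(ltW d0).
Qed.

Lemma sin_lip (D : set R) : lip D (@sin R).
Proof.
have le_sin (x y : R) : x < y -> `|sin x - sin y| <= 1 * `|x - y|.
  move=> xy; rewrite distrC.
  have [c _ ->] := MVT xy (fun z _ => is_derive_sin z)
    (continuous_subspaceT (@continuous_sin R)).
  by rewrite normrM [`|y - x|]distrC ler_wpM2r// cos_max.
exists 1 => x y _ _; have [/le_sin//|yx|->] := ltgtP x y.
  by rewrite distrC [`|x - y|]distrC le_sin.
by rewrite !subrr normr0 mulr0.
Qed.

Lemma lip_continuous {V W : normedModType R} (f : V -> W) :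
  lip [set: V] f -> continuous f.
Proof.
move=> /lip_ge0[k k0 fk] x; apply/cvgrPdist_lt => eps eps0; near=> y.
apply: le_lt_trans (fk x y I I) _.
apply: (@le_lt_trans _ _ ((k + 1) * `|x - y|)); first by rewrite ler_wpM2r// lerDl.
rewrite -ltr_pdivlMl ?ltr_wpDl//; near: y; apply/nbhs_normP.
exists ((k + 1)^-1 * eps); rewrite /= ?mulr_gt0 ?invr_gt0 ?ltr_wpDl//.
Unshelve. all: by end_near. Qed.

End lipschitz_on_sets.

(** * The function [t * sin (1 / t)] *)

Section oscillating_function.
Context {R : realType}.

Definition osc (t : R) : R := t * sin t^-1.

Lemma osc0 : osc 0 = 0. Proof. by rewrite /osc mul0r. Qed.

Lemma osc_continuous : continuous osc.
Proof.
move=> t; have [->|t0] := eqVneq t 0; last first.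
  apply: continuousM; first exact: cvg_id.
  apply: (@continuous_comp _ _ _ (fun x : R => x^-1) (@sin R)).
    exact: (@continuousV _ _ id).
  exact: continuous_sin.
(* Near [0] the estimate [|osc x| <= |x|] suffices. *)
rewrite /continuous_at osc0; apply/cvgrPdist_lt => eps eps0; near=> x.
rewrite sub0r normrN /osc normrM.
apply: (@le_lt_trans _ _ `|x|); first by rewrite ler_piMr ?sin_max.
rewrite -[x]subr0 distrC; near: x.
exact: (@cvgr_dist_lt _ _ _ _ _ id 0).
Unshelve. all: by end_near. Qed.

(** At these heights [t^-1] is [pi / 2] plus a multiple of [pi], where the sine is alternately [1]
    and [-1]; they become the levels of the oscillation argument. *)
Lemma osc_peak (k : nat) (t := (pi / 2 + pi *+ k)^-1 : R) : osc t = (-1) ^+ k * t.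
Proof.
by rewrite /osc /t invrK (alternatingn (@sinDpi R)) sin_pihalf mulr1 mulrC.
Qed.

End oscillating_function.

(** * Inverses on compact sets and the harmonic series *)

Lemma within_continuous_inverse (T U : topologicalType) (C : set T)
    (h : T -> U) (g : U -> T) :
  hausdorff_space U -> compact C -> {within C, continuous h} ->
  (forall x, C x -> g (h x) = x) -> {within h @` C, continuous g}.
Proof.
move=> hU cC ch gh; apply/continuous_closedP => K cK.
(* Within the image of [C], the preimage of the closed set [K] under [g] is the image of the part of
   [C] in [K], which is compact and so closed. *)
apply/closed_subspaceP; exists (h @` (C `&` K)).
  apply: compact_closed => //; apply: continuous_compact.
    by apply: continuous_subspaceW ch => x [].
  exact: compact_closedI.
apply/seteqP; split => y /=.
  move=> [[x [Cx Kx] <-] _]; split; last by exists x.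
  by have Kgx : K (g (h x)) by rewrite gh.
move=> [Kgy [x Cx xy]].
have Kx : K (g (h x)) by rewrite xy.
by rewrite gh// in Kx; split; exists x.
Qed.

Lemma series_harmonic_unbounded (R : realType) (L : R) :
  exists K, L < \sum_(0 <= k < K) harmonic k.
Proof.
apply: contrapT => noK; apply: (@dvg_harmonic R).
apply: nondecreasing_is_cvgn.
  apply/nondecreasing_seqP => k; rewrite /series/= big_nat_recr//= lerDl.
  by rewrite invr_ge0.
exists L => _ [K _ <-]; rewrite leNgt; apply/negP => LK; apply: noK.
by exists K.
Qed.

(** * The dot product and the comparison of norms *)

Section dot_product.
Set Implicit Arguments.
Unset Strict Implicit.
Context {R : realType} {n : nat}.
Implicit Types (a x y : 'rV[R]_n) (c : R).

Definition dot a x : R := \sum_(i < n) a 0 i * x 0 i.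

Lemma dotDr a x y : dot a (x + y) = dot a x + dot a y.
Proof. by rewrite -big_split/=; apply: eq_bigr => i _; rewrite mxE mulrDr. Qed.

Lemma dotZr a c x : dot a (c *: x) = c * dot a x.
Proof. by rewrite mulr_sumr; apply: eq_bigr => i _; rewrite mxE mulrCA. Qed.

Lemma dotNr a x : dot a (- x) = - dot a x.
Proof. by rewrite -scaleN1r dotZr mulN1r. Qed.

Lemma dotC a x : dot a x = dot x a.
Proof. by apply: eq_bigr => i _; rewrite mulrC. Qed.

Lemma dotNl a x : dot (- a) x = - dot a x.
Proof. by rewrite dotC dotNr dotC. Qed.

Lemma dot_gt0 a : a != 0 -> 0 < dot a a.
Proof.
move=> a0; rewrite lt_neqAle sumr_ge0 ?andbT => [|i _]; last by rewrite -expr2 sqr_ge0.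
apply: contra a0; rewrite eq_sym psumr_eq0 => [/allP h|i _]; last first.
  by rewrite -expr2 sqr_ge0.
apply/eqP/rowP => i; rewrite mxE.
by have := h i (mem_index_enum _); rewrite /= mulf_eq0 orbb => /eqP.
Qed.

Lemma norm_le_edist x y : `|x - y| <= Defs.edist x y.
Proof.
rewrite [leLHS]/Num.Def.normr/= mx_normrE.
apply/bigmax_leP; split => [|[i j] _ /=]; first exact: Defs.edist_ge0.
by rewrite !mxE ord1 le_coord_edist.
Qed.

Lemma coord_le_norm x i : `|x 0 i| <= `|x|.
Proof.
rewrite [leRHS]/Num.Def.normr/= mx_normrE.
exact: (le_bigmax _ (fun ij : 'I_1 * 'I_n => `|x ij.1 ij.2|) (0, i)).
Qed.

(** The crude bound [n <= (n + 1) ^ 2] is used under the root. Together with [norm_le_edist], this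
    transfers Lipschitz estimates from the sup norm to the Euclidean distance. *)
Lemma edist_le_norm x y : Defs.edist x y <= n.+1%:R * `|x - y|.
Proof.
rewrite -[leRHS]ger0_norm ?mulr_ge0// -sqrtr_sqr ler_wsqrtr//.
apply: (@le_trans _ _ (\sum_(i < n) `|x - y| ^+ 2)).
  apply: ler_sum => i _; rewrite -[leLHS]real_normK ?num_real//.
  rewrite lerXn2r ?nnegrE//.
  by have := coord_le_norm (x - y) i; rewrite !mxE.
rewrite sumr_const card_ord -[leLHS]mulr_natl exprMn ler_wpM2r ?exprn_ge0//.
by rewrite -natrX ler_nat expnS expn1 mulSn (leq_trans (leqnSn n))// leq_addr.
Qed.

Lemma dot_le a x : `|dot a x| <= (\sum_(i < n) `|a 0 i|) * `|x|.
Proof.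
apply: le_trans (ler_norm_sum _ _ _) _; rewrite mulr_suml.
by apply: ler_sum => i _; rewrite normrM ler_wpM2l// coord_le_norm.
Qed.

Lemma dot_lip a (D : set 'rV[R]_n) : lip D (dot a).
Proof.
exists (\sum_(i < n) `|a 0 i|) => x y _ _.
by rewrite -dotNr -dotDr dot_le.
Qed.

Lemma dot_edist a : exists2 k, 0 < k &
  forall x y, `|dot a x - dot a y| <= k * Defs.edist x y.
Proof.
have S0 : 0 <= \sum_(i < n) `|a 0 i| by exact: sumr_ge0.
(* The extra [1] keeps the constant positive even when [a] is zero. *)
exists (1 + \sum_(i < n) `|a 0 i|) => [|x y]; first by rewrite ltr_wpDr.
rewrite -dotNr -dotDr (le_trans (dot_le _ _))//.
by rewrite ler_pM// ?norm_le_edist// lerDr.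
Qed.

Lemma mdist_lip (D : set 'rV[R]_n) (f : 'rV[R]_n -> 'rV[R]_n) : lip D f ->
  exists2 c, 0 < c & forall x y, D x -> D y ->
    Defs.edist (f x) (f y) <= c * Defs.edist x y.
Proof.
move=> /lip_ge0[k k0 fk]; exists (n.+1%:R * (k + 1)).
  by rewrite mulr_gt0// ltr_wpDl.
move=> x y Dx Dy; apply: le_trans (edist_le_norm _ _) _.
rewrite -mulrA ler_wpM2l//; apply: le_trans (fk _ _ Dx Dy) _.
by rewrite ler_pM ?norm_le_edist// lerDl.
Qed.

(** If the coordinate [a_i] is nonzero, [a_j e_i - a_i e_j] works for any [j] other than [i],
    available in dimension at least two; if [a] is zero, any basis vector does. *)
Lemma exists_orthogonal a : (2 <= n)%N -> exists2 v, v != 0 & dot a v = 0.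
Proof.
move=> n2; have [a0|/rV0Pn[i ai]] := eqVneq a 0.
  pose i := Ordinal (ltnW n2); exists (delta_mx 0 i).
    by apply/rV0Pn; exists i; rewrite mxE !eqxx oner_eq0.
  by rewrite a0 /dot big1// => j _; rewrite mxE mul0r.
have [j ij] : exists j : 'I_n, j != i.
  pose j0 := Ordinal (ltnW n2); pose j1 := Ordinal n2.
  by have [<-|] := eqVneq j0 i; [exists j1|exists j0].
exists (a 0 j *: delta_mx 0 i - a 0 i *: delta_mx 0 j).
  apply/rV0Pn; exists j.
  by rewrite !mxE !eqxx/= (negbTE ij) mulr0 sub0r mulr1 oppr_eq0.
have dot_delta l : dot a (delta_mx 0 l) = a 0 l.
  rewrite /dot (bigD1 l)//= mxE !eqxx mulr1 big1 ?addr0// => m ml.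
  by rewrite mxE (negbTE ml) andbF mulr0.
by rewrite dotDr dotNr !dotZr !dot_delta mulrC subrr.
Qed.

End dot_product.

(** * The twisting map and its inverse *)

Section twist.
Context {R : realType} {n : nat} (a v p : 'rV[R]_n).
Context (a0 : a != 0) (av : dot a v = 0).
Set Implicit Arguments.
Unset Strict Implicit.

(* The image of a set lying in the half-space above [p] is a tube of radius
   [O(t^2)] around the curve [t |-> (t / |a|^2) a + osc t v]; the coefficient
   of [a] is corrected so that heights are preserved exactly. *)
Definition twist (x : 'rV[R]_n) : 'rV[R]_n :=
  let t := dot a (x - p) in
  t ^+ 2 *: (x - p) + ((t - t ^+ 3) / dot a a) *: a + osc t *: v.

(* At height [0] the inverse is the junk value [0^-1 = 0], so [untwist 0 = p]. *)
Definition untwist (z : 'rV[R]_n) : 'rV[R]_n :=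
  let t := dot a z in
  p + t ^- 2 *: (z - ((t - t ^+ 3) / dot a a) *: a - osc t *: v).

(** The squeezed vector has height [t ^+ 3], the multiple of [a] has height [t - t ^+ 3], and [v] is
    horizontal. *)
Lemma dot_twist_height x : dot a (twist x) = dot a (x - p).
Proof.
rewrite /twist !dotDr !dotZr av -dotDr mulr0 addr0 divfK; first by ring.
by rewrite gt_eqF// dot_gt0.
Qed.

(** Along [v], the peaks of the oscillation are of order [t] and outweigh, at small heights, the
    other term, which is of order [t ^+ 2] on bounded sets. *)
Lemma dot_twist_osc x (t := dot a (x - p)) :
  dot v (twist x) = t ^+ 2 * dot v (x - p) + osc t * dot v v.
Proof.
by rewrite /twist -/t dotDr dotDr !dotZr (dotC v a) av mulr0 addr0.
Qed.

Lemma twist_base : twist p = 0.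
Proof.
rewrite /twist; have -> : dot a (p - p) = 0 by rewrite dotDr dotNr subrr.
by rewrite subrr scaler0 !expr0n/= subrr mul0r osc0 !scale0r !addr0.
Qed.

(** Heights are preserved, so [t] can be read off the image; removing the curve and dividing by
    [t ^+ 2] recovers [x - p]. The first alternative covers height [0], where that division breaks
    down. *)
Lemma twistK x : x = p \/ 0 < dot a (x - p) -> untwist (twist x) = x.
Proof.
case=> [->|tx]; rewrite /untwist.
  rewrite twist_base; have -> : dot a 0 = 0 by rewrite -(scale0r 0) dotZr mul0r.
  by rewrite expr0n/= invr0 scale0r addr0.
rewrite dot_twist_height /twist.
have cancel2 (x1 x2 x3 : 'rV[R]_n) : x1 + x2 + x3 - x2 - x3 = x1.
  by rewrite (addrAC (x1 + x2)) !addrK.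
rewrite cancel2 scalerA mulVf ?scale1r ?subrKC//.
by rewrite expf_neq0// gt_eqF.
Qed.

Lemma height_continuous : continuous (fun x : 'rV[R]_n => dot a (x - p)).
Proof. by apply: lip_continuous; exact: lip_comp (lip_subr _ p) _ (dot_lip a setT). Qed.

Lemma twist_continuous : continuous twist.
Proof.
have ht := height_continuous.
have comp_ht (g : R -> R) : continuous g ->
    continuous (fun x : 'rV[R]_n => g (dot a (x - p))).
  by move=> cg x; exact: (@continuous_comp _ _ _ _ g x (ht x) (cg _)).
have -> : twist = (fun x : 'rV[R]_n => dot a (x - p) ^+ 2 *: (x - p)) \+
    (fun x : 'rV[R]_n => ((dot a (x - p) - dot a (x - p) ^+ 3) / dot a a) *: a) \+
    (fun x : 'rV[R]_n => osc (dot a (x - p)) *: v) by [].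
move=> x; apply: continuousD; first apply: continuousD.
- apply: continuousZ; first apply: (comp_ht (fun t => t ^+ 2)).
  exact: exprn_continuous.
  exact: (lip_continuous (lip_subr setT p)).
- apply: continuousZl; apply: continuousM; last exact: cst_continuous.
  apply: continuousB; first exact: ht.
  apply: (comp_ht (fun t => t ^+ 3)).
  exact: exprn_continuous.
- by apply: continuousZl; apply: comp_ht; exact: osc_continuous.
Qed.

(** The one ingredient that is not Lipschitz on bounded sets is [t^-1] inside the sine, which
    [delta] controls; [M] serves the products. *)
Lemma twist_lip (D : set 'rV[R]_n) (M delta : R) :
  (forall x, D x -> `|x| <= M) -> 0 < delta ->
  (forall x, D x -> delta <= dot a (x - p)) -> lip D twist.
Proof.
move=> DM d0 Dd; pose t x := dot a (x - p).
have Lt : lip D t.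
  exact: lip_comp (lip_subr _ p) (@subsetT _ _) (dot_lip a setT).
have Lt2 : lip D (fun x => t x ^+ 2) by exact: (lip_scale DM Lt Lt).
have Lt3 : lip D (fun x => t x ^+ 3) by exact: (lip_scale DM Lt Lt2).
apply: lip_add; first apply: lip_add.
- exact: (lip_scale DM Lt2 (lip_subr _ p)).
- apply: (lip_scale DM _ (lip_cst _ a)).
  apply: (lip_scale (W := R) DM _ (lip_cst _ (dot a a)^-1)).
  apply: lip_add => //.
  have := lip_scale (W := R) DM (lip_cst D (-1 : R)) Lt3.
  by under eq_fun do rewrite /GRing.scale/= mulN1r.
- apply: (lip_scale DM _ (lip_cst _ v)).
  apply: (lip_scale (W := R) DM Lt).
  apply: (lip_comp (E := setT) (f := fun x => (t x)^-1)) => //; last exact: sin_lip.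
  by apply: (lip_comp Lt _ (lip_inv d0)) => _ [x Dx <-]; exact: Dd.
Qed.

End twist.

(** [euclid R n] carries the topology of the row vectors, so compactness there gives a bound in the
    sup norm. *)
Lemma compact_norm_bounded (R : realType) (n : nat) (K : set (euclid R n)) : compact K ->
  exists2 M, 0 <= M & forall x : 'rV[R]_n, K x -> `|x| <= M.
Proof.
move=> cK; have [M [_ KM]] := @compact_bounded R 'rV[R]_n K cK.
exists `|M + 1| => // x Kx; apply: le_trans (KM (M + 1) _ x Kx) (ler_norm _).
by rewrite ltrDl.
Qed.

(** * Chain distances in the twisted image *)

Section twist_image.
Context {R : realType} {n : nat} (a v p : 'rV[R]_n).
Context (a0 : a != 0) (v0 : v != 0) (av : dot a v = 0).
Context (C : set (euclid R n)) (C_compact : compact C)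
  (C_above : forall x, (C `\ p) x -> 0 < dot a ((x : 'rV[R]_n) - p)).

Local Notation h := (twist a v p : euclid R n -> euclid R n).

Lemma twist_dtilde_infinite x :
  (C `\ p) x -> ~ dtilde_fin (h x) (0 : euclid R n) (h @` C).
Proof.
move=> Cpx; have tx := C_above Cpx; have V0 := dot_gt0 v0.
have [M M0 CM] : exists2 M, 0 <= M &
    forall y : 'rV[R]_n, C y -> `|dot v (y - p)| <= M.
  have [N N0 CN] := @compact_norm_bounded _ _ _ C_compact.
  pose D : set 'rV[R]_n := C.
  have DN y : D y -> `|y| <= N by exact: CN.
  have dlip : lip D (fun y => dot v (y - p)).
    exact: lip_comp (lip_subr _ p) (@subsetT _ _) (dot_lip v setT).
  exact: (lip_bounded DN dlip).
have [ka ka0 aka] := dot_edist a; have [kv kv0 vkv] := dot_edist v.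
pose T j : R := (pi / 2 + pi *+ j)^-1.
have pi0 := @pi_gt0 R.
have P0 j : 0 < pi / 2 + pi *+ j :> R.
  by rewrite ltr_pwDl ?divr_gt0// mulrn_wge0// ltW.
have T0 j : 0 < T j by rewrite invr_gt0.
have Tdec j : T j.+1 < T j.
  by rewrite ltf_pV2 ?posrE// ltrD2l mulrS ltrDr.
(* Levels below [B] lie under the height of [x], and there the error [t ^+ 2 * M] is at most a
   quarter of [T l * dot v v]. *)
pose B := Num.min (dot a ((x : 'rV[R]_n) - p)) (dot v v / (4 * (M + 1))).
have B0 : 0 < B.
  by rewrite lt_min tx divr_gt0// mulr_gt0// ltr_wpDl.
(* The even start [m.*2] makes the sign at level [m.*2 + j] equal to [(-1) ^+ j]. *)
have [m Tm] : exists m, T m.*2 < B.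
  exists (Num.bound B^-1); rewrite invf_plt ?posrE//.
  apply: lt_le_trans (archi_boundP _) _; first by rewrite invr_ge0 ltW.
  set b := Num.bound _; rewrite -mul2n mulrnA -[X in _ <= _ + X]mulr_natr.
  have pi2 := @pi_ge2 R; have b0 : 0 <= b%:R :> R by [].
  by rewrite mulr2n; nra.
have TB j : T (m.*2 + j)%N < B.
  elim: j => [|j]; first by rewrite addn0.
  by rewrite addnS; apply: lt_trans (Tdec _).
(* Three quarters of the peak, kept by continuity of [osc], minus one quarter lost to the error,
   leave one half. *)
pose w j := dot v v / 2 * T (m.*2 + j)%N.
apply: (@oscillation_dtilde_infinite R (euclid R n) (h @` C) (dot a) (dot v)
  (ka + kv) (fun j => T (m.*2 + j)%N) w (h x) 0).
- exact: addr_gt0.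
- move=> y z; apply: le_trans (aka y z) _.
  by rewrite ler_wpM2r ?Defs.edist_ge0// lerDl ltW.
- move=> y z; apply: le_trans (vkv y z) _.
  by rewrite ler_wpM2r ?Defs.edist_ge0// lerDr ltW.
- by move=> j; rewrite addnS Tdec.
- by move=> j; rewrite mulr_ge0 ?divr_ge0// ltW.
- move=> j; set l := (m.*2 + j)%N.
  have Tl0 := T0 l.
  have /cvgrPdist_lt/(_ (T l / 4)) := @osc_continuous R (T l).
  rewrite divr_gt0// => /(_ isT)/nbhs_normP[e /= e0 osc_near].
  (* The radius [e] keeps [osc] within [T l / 4] of its peak; the cap [T l] keeps heights in the
     window positive. *)
  exists (Num.min e (T l)) => [|_ [y Cy <-]]; first by rewrite lt_min e0 Tl0.
  rewrite dot_twist_height// dot_twist_osc//; set t := dot a _.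
  move=> /andP[et tT].
  have t0 : 0 < t.
    by apply: (le_lt_trans _ et); rewrite subr_ge0 ge_min lexx orbT.
  have /osc_near : `|T l - t| < e.
    rewrite ger0_norm ?subr_ge0// ltrBlDr -ltrBlDl.
    by apply: (le_lt_trans _ et); rewrite lerD2l lerN2 ge_min lexx.
  rewrite osc_peak -/(T l) /w -/l => osct.
  have sgn : (-1) ^+ l = (-1) ^+ j :> R by rewrite exprD -signr_odd odd_double mul1r.
  rewrite sgn in osct.
  have oscl : 3 / 4 * T l <= (-1) ^+ j * osc t.
    have : `|(-1) ^+ j * ((-1) ^+ j * T l - osc t)| < T l / 4.
      by rewrite normrM normrX normrN1 expr1n mul1r.
    rewrite mulrBr mulrA -expr2 sqrr_sign mul1r => /ltr_normlP[_].
    by lra.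
  have rM : - M <= (-1) ^+ j * dot v ((y : 'rV[R]_n) - p).
    rewrite lerNl -mulrN; apply: le_trans (ler_norm _) _.
    by rewrite normrM normrX normrN1 expr1n mul1r normrN CM.
  have TMV : T l * (4 * (M + 1)) < dot v v.
    rewrite -ltr_pdivlMr ?mulr_gt0 ?ltr_wpDl//.
    by apply: lt_le_trans (TB j) _; rewrite ge_min lexx orbT.
  have t2 : t ^+ 2 * M <= T l * (dot v v / 4).
    apply: (@le_trans _ _ (T l ^+ 2 * M)).
      by rewrite ler_wpM2r//; apply: lerXn2r => //; rewrite nnegrE ltW.
    rewrite expr2 -mulrA ler_pM2l//; nra.
  have -> : (-1) ^+ j * (t ^+ 2 * dot v ((y : 'rV[R]_n) - p) + osc t * dot v v) =
      t ^+ 2 * ((-1) ^+ j * dot v ((y : 'rV[R]_n) - p)) +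
      ((-1) ^+ j * osc t) * dot v v by ring.
  have t20 : 0 <= t ^+ 2 by exact: sqr_ge0.
  have := ler_wpM2l t20 rM; have := ler_wpM2r (ltW V0) oscl.
  rewrite mulrN; lra.
- move=> L.
  (* Since [pi / 2 + pi * (2m + j) <= pi * (2m + 1) * (j + 1)], the weights dominate [k0] times the
     harmonic series. *)
  pose k0 := dot v v / 2 / (pi * m.*2.+1%:R).
  have k00 : 0 < k0 by rewrite !divr_gt0// mulr_gt0.
  have [K LK] := series_harmonic_unbounded (L / k0).
  exists K; rewrite ltr_pdivrMr// in LK; apply: lt_le_trans LK _.
  rewrite mulr_suml; apply: ler_sum => j _; rewrite /w /k0 /harmonic/=.
  rewrite mulrCA ler_pM2l ?divr_gt0// -invfM lef_pV2 ?posrE ?mulr_gt0//.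
  rewrite -[pi *+ _]mulr_natr natrD -[m.*2.+1%:R]natr1 -[j.+1%:R]natr1.
  have m0 : 0 <= m.*2%:R :> R by []; have j0 : 0 <= j%:R :> R by [].
  have mj := mulr_ge0 m0 j0; have := mulr_ge0 (ltW pi0) mj; nra.
- rewrite dot_twist_height// addn0; apply: lt_le_trans Tm _.
  by rewrite ge_min lexx.
- by move=> j; rewrite -(scale0r 0) dotZr mul0r.
Qed.

(** Removing the interior of [U] from [C] leaves a compact set without [p], on which the height has
    a positive minimum; there the twist is Lipschitz and stretches chains by a bounded factor. *)
Lemma twist_dtilde_finite (U : set (euclid R n)) x y :
  nbhs p U -> C x -> ~ U x -> (dtilde x y (C `\` U) < +oo)%E ->
  dtilde_fin (h x) (h y) (h @` C).
Proof.
move=> pU Cx Ux /dtilde_lt_pinfty fin_xy.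
pose D : set (euclid R n) := C `&` ~` U^°.
have cD : compact D.
  by apply: compact_closedI => //; rewrite closedC; exact: open_interior.
have Dx : D x by split => // /interior_subset.
have DC : D `<=` C by move=> z [].
have CUD : C `\` U `<=` D by move=> z [Cz Uz]; split => // /interior_subset.
have [z zD zmin] := @compact_EVT_min (euclid R n) R
  (fun y : 'rV[R]_n => dot a (y - p)) D (ex_intro _ x Dx) cD
  (continuous_subspaceT (@height_continuous R n a p)).
rewrite inE in zD.
have z0 : 0 < dot a ((z : 'rV[R]_n) - p).
  apply: C_above; split; first exact: DC.
  by move=> zp; case: zD => _; apply; rewrite zp.
have [M _ DM] := @compact_norm_bounded _ _ _ cD.
have Dlip : lip (D : set 'rV[R]_n) (twist a v p).
  apply: (@twist_lip R n a v p D M _ DM z0) => w Dw; apply: zmin; rewrite inE//.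
have [c c0 hc] := mdist_lip Dlip.
apply: (@dtilde_fin_image R (euclid R n) (euclid R n) h D _ x y c c0 hc).
  by move=> _ [w Dw <-]; exists w => //; exact: DC.
exact: dtilde_fin_subset fin_xy.
Qed.

End twist_image.

(** * The side of the hyperplane and the conclusion *)

Lemma hyperplane_side (R : realType) (n : nat) (a p : 'rV[R]_n)
    (A : set (euclid R n)) :
  a != 0 -> connected A -> (forall x, A x -> dot a ((x : 'rV[R]_n) - p) != 0) ->
  exists2 a', a' != 0 & forall x, A x -> 0 < dot a' ((x : 'rV[R]_n) - p).
Proof.
move=> a0 cA An0; pose f (x : euclid R n) := dot a ((x : 'rV[R]_n) - p).
(* The heights form an interval that omits [0], so they share one sign; unless some height is
   positive, [- a] replaces [a]. *)
have /connected_intervalP fA : connected (f @` A).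
  apply: connected_continuous_connected => //.
  exact: (continuous_subspaceT (@height_continuous R n a p)).
have [[x Ax fx]|neg] := pselect (exists2 x, A x & 0 < f x).
  exists a => // y Ay; rewrite lt_neqAle eq_sym An0//= leNgt; apply/negP => fy.
  have [z Az /eqP] : (f @` A) 0.
    by apply: (fA (f y) (f x)); [exists y|exists x|rewrite !ltW].
  by rewrite /f (negbTE (An0 z Az)).
exists (- a) => [|y Ay]; first by rewrite oppr_eq0.
rewrite dotNl oppr_gt0 lt_neqAle An0//= leNgt; apply/negP => fy.
by apply: neg; exists y.
Qed.

Theorem theorem2p2 (R : realType) (n : nat) (n_ge2 : (2 <= n)%N)
    (C : set (euclid R n)) (C_continuum : continuum C)
    (B : set (euclid R n)) (B_hyperplane : hyperplane B)
    (p : euclid R n) (BC : B `&` C = [set p])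
    (Cp_nonempty : (C `\ p) !=set0) (Cp_connected : connected (C `\ p))
    (Cp_dtilde : forall x y, (C `\ p) x -> (C `\ p) y ->
      exists U : set (euclid R n),
        [/\ nbhs p U, ~ U x, ~ U y & (dtilde x y (C `\` U) < +oo)%E]) :
  exists h : euclid R n -> euclid R n,
    embedding_on C h /\
    forall (m : nat) (F : 'I_m.+1 -> euclid R n -> euclid R n),
      is_ifs F -> ~ attractor F (h @` C).
Proof.
have [_ cC connC] := C_continuum.
have [a1 [b [a10 BE]]] := B_hyperplane.
have [Bp Cp] : (B `&` C) p by rewrite BC.
have [a a0 Ca] : exists2 a : 'rV[R]_n, a != 0 &
    forall x, (C `\ p) x -> 0 < dot a ((x : 'rV[R]_n) - p).
  (* As [p] lies on [B], a point at height [0] relative to [p] also lies on [B], which meets [C]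
     only in [p]. *)
  apply: (@hyperplane_side R n a1 p (C `\ p) a10 Cp_connected) => x [Cx xp].
  apply/eqP; rewrite dotDr dotNr => /eqP; rewrite subr_eq0 => /eqP axp.
  apply: xp; suff : (B `&` C) x by rewrite BC.
  by split => //; move: Bp; rewrite BE /= -!/(dot _ _) axp.
have [v v0 av] := exists_orthogonal a n_ge2.
pose h : euclid R n -> euclid R n := twist a v p.
have hC : {within C, continuous h}.
  exact: (continuous_subspaceT (@twist_continuous R n a v p)).
have hK x : C x -> untwist a v p (h x) = x.
  move=> Cx; apply: twistK => //.
  have [->|xp] := eqVneq x p; [by left|right].
  by apply: Ca; split => //; exact/eqP.
have hp : h p = 0 by exact: twist_base.
have Ahp z : ((h @` C) `\ h p) z -> exists2 x, (C `\ p) x & h x = z.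
  move=> [[x Cx xz] zp]; exists x => //; split => // xp.
  by apply: zp; rewrite -xz xp.
exists h; split.
  split => //; exists (untwist a v p); split => //.
  by apply: (@within_continuous_inverse (euclid R n) (euclid R n) C h) => //;
    exact: metric_hausdorff.
apply: (@not_attractor R (euclid R n) (h @` C) (h p)).
- exact: connected_continuous_connected.
- by exists p.
- have [x [Cx xp]] := Cp_nonempty; exists (h x); split; first by exists x.
  by move=> hxp; apply: xp; rewrite -(hK x)// hxp hK.
- move=> _ _ /Ahp[x Cpx <-] /Ahp[y Cpy <-].
  have [U [pU Ux Uy xyU]] := Cp_dtilde x y Cpx Cpy.
  by apply: (@twist_dtilde_finite R n a v p C cC Ca U x y pU _ Ux xyU); case: Cpx.
- by move=> _ /Ahp[x Cpx <-]; rewrite hp; exact: twist_dtilde_infinite.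
Qed.
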